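(* For every integer $m$ with $2\leq m\leq 22$ and every integer $n\geq 3$, $a_m\, n\leq mp_{f,2}(P_m\square C_n)$, where $$a_2=\tfrac12,\quad a_3=\tfrac23,\quad a_4=\tfrac45,\quad a_5=\tfrac{26}{27},\quad a_6=\tfrac{29}{26},\quad a_7=\tfrac{19}{15},\quad a_8=\tfrac{212}{149},$$ $$a_9=\tfrac{52}{33},\quad a_{10}=\tfrac{780}{451},\quad a_{11}=\tfrac{81}{43},\quad a_{12}=\tfrac{273}{134},\quad a_{13}=\tfrac{5042}{2301},\quad a_{14}=\tfrac{2324}{991},\quad a_{15}=\tfrac{5690}{2277},$$ $$a_{16}=\tfrac{15593}{5878},\quad a_{17}=\tfrac{28417}{10125},\quad a_{18}=\tfrac{103240}{34873},\quad a_{19}=\tfrac{3896}{1251},\quad a_{20}=\tfrac{337976}{103415},\quad a_{21}=\tfrac{304705}{89043},\quad a_{22}=\tfrac{548313}{153338}.$$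
   Context: $P_m$ denotes the path on $m$ vertices, $C_n$ the cycle on $n$ vertices, and $\square$ the Cartesian product of graphs; $d$ denotes graph distance. For a finite graph $G$, the fractional $2$-limited multipacking number $mp_{f,2}(G)$ is the optimal value of the linear program: maximize $\sum_{i\in V(G)}y_i$ over real variables $(y_i)_{i\in V(G)}$ subject to $y_i\geq 0$ for every $i\in V(G)$ and $\sum_{i\in V(G):\, d(i,j)\leq \ell}y_i\leq \ell$ for every vertex $j\in V(G)$ and every $\ell\in\{1,2\}$. *)

(* Defs.v *)
From HB Require Import structures.
From mathcomp Require Import all_boot all_order all_algebra.
From mathcomp Require Import boolp classical_sets reals.

Set Implicit Arguments.
Unset Strict Implicit.
Unset Printing Implicit Defensive.

Import Order.TTheory GRing.Theory Num.Theory.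
Local Open Scope ring_scope.

Record sgraph := SGraph {
  svertex :> finType;
  sedge : rel svertex;
  sedge_sym : symmetric sedge;
  sedge_irr : irreflexive sedge
}.

Section PathCycle.
Variable n : nat.

Definition path_rel : rel 'I_n :=
  fun i j => (i.+1 == j :> nat) || (j.+1 == i :> nat).

Lemma path_rel_sym : symmetric path_rel.
Proof. by move=> i j; rewrite /path_rel orbC. Qed.

Lemma path_rel_irr : irreflexive path_rel.
Proof. by move=> i; rewrite /path_rel -{2 4}[val i]addn0 -addn1 eqn_add2l. Qed.

Definition path_graph : sgraph := SGraph path_rel_sym path_rel_irr.

(* [ordS] is the successor modulo n.  This is the n-cycle for n >= 3; the
   conjunct [i != j] only matters for n = 1. *)
Definition cycle_rel : rel 'I_n :=
  fun i j => (i != j) && ((ordS i == j) || (ordS j == i)).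

Lemma cycle_rel_sym : symmetric cycle_rel.
Proof. by move=> i j; rewrite /cycle_rel eq_sym orbC. Qed.

Lemma cycle_rel_irr : irreflexive cycle_rel.
Proof. by move=> i; rewrite /cycle_rel eqxx. Qed.

Definition cycle_graph : sgraph := SGraph cycle_rel_sym cycle_rel_irr.
End PathCycle.

Section CartesianProduct.
Variables G H : sgraph.

Definition cprod_rel : rel (G * H)%type := fun u v =>
  ((u.1 == v.1) && sedge u.2 v.2) || ((u.2 == v.2) && sedge u.1 v.1).

Lemma cprod_rel_sym : symmetric cprod_rel.
Proof.
move=> u v; rewrite /cprod_rel.
by rewrite (eq_sym u.1) (eq_sym u.2) (sedge_sym u.1) (sedge_sym u.2).
Qed.

Lemma cprod_rel_irr : irreflexive cprod_rel.
Proof. by move=> u; rewrite /cprod_rel !sedge_irr !andbF. Qed.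

Definition cprod_graph : sgraph := SGraph cprod_rel_sym cprod_rel_irr.
End CartesianProduct.

Section Distance.
Variable G : sgraph.

Definition has_walk (x y : G) (k : nat) : bool :=
  [exists p : k.-tuple G, path (@sedge G) x p && (last x p == y)].

(* [None] stands for an infinite distance (different components). *)
Definition gdist (x y : G) : option nat :=
  if pselect (exists k, has_walk x y k) is left ex
  then Some (ex_minn ex) else None.

Definition gdist_le (x y : G) (l : nat) : bool :=
  if gdist x y is Some d then (d <= l)%N else false.

Lemma gdist_le_refl (x : G) (l : nat) : gdist_le x x l.
Proof.
have w0 : has_walk x x 0 by apply/existsP; exists [tuple]; rewrite /= eqxx.
rewrite /gdist_le /gdist; case: pselect => [ex|[]]; last by exists 0%N.
by case: ex_minnP => k _ /(_ 0%N w0); rewrite leqn0 => /eqP->.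
Qed.
End Distance.

Section FractionalMultipacking.
Variables (R : realType) (G : sgraph).

Definition mp_feasible (y : G -> R) : Prop :=
  (forall i, 0 <= y i) /\
  (forall (j : G) (l : nat), (1 <= l <= 2)%N ->
     \sum_(i | gdist_le i j l) y i <= l%:R).

Definition mp_values : set R :=
  [set v | exists y : G -> R, mp_feasible y /\ v = \sum_i y i].

Definition mp_f2 : R := sup mp_values.

Lemma mp_values_has_sup : has_sup mp_values.
Proof.
split.
  exists 0, (fun=> 0); split; last by rewrite big1.
  by split=> // j l _; rewrite big1.
exists (\sum_(i : G) 1) => _ [y [[y_ge0 ylim] ->]].
apply: ler_sum => j _; apply: le_trans (ylim j 1%N isT).
by rewrite (bigD1 j) ?gdist_le_refl //= lerDl sumr_ge0.
Qed.
End FractionalMultipacking.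

(* The value outside 2 <= m <= 22 is irrelevant. *)
Definition mp_coeff (R : realType) (m : nat) : R :=
  match m with
  | 2%N => 1 / 2%:R
  | 3%N => 2%:R / 3%:R
  | 4%N => 4%:R / 5%:R
  | 5%N => 26%:R / 27%:R
  | 6%N => 29%:R / 26%:R
  | 7%N => 19%:R / 15%:R
  | 8%N => 212%:R / 149%:R
  | 9%N => 52%:R / 33%:R
  | 10%N => 780%:R / 451%:R
  | 11%N => 81%:R / 43%:R
  | 12%N => 273%:R / 134%:R
  | 13%N => 5042%:R / 2301%:R
  | 14%N => 2324%:R / 991%:R
  | 15%N => 5690%:R / 2277%:R
  | 16%N => 15593%:R / 5878%:R
  | 17%N => 28417%:R / 10125%:R
  | 18%N => 103240%:R / 34873%:R
  | 19%N => 3896%:R / 1251%:R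
  | 20%N => 337976%:R / 103415%:R
  | 21%N => 304705%:R / 89043%:R
  | 22%N => 548313%:R / 153338%:R
  | _ => 0
  end.

(* Main.v *)
Require Import Defs.
From Stdlib Require Import NArith.
From mathcomp Require Import all_boot all_order all_algebra.
From mathcomp Require Import boolp classical_sets reals.
From mathcomp Require Import zify.
Import Order.TTheory GRing.Theory Num.Theory.
Local Open Scope ring_scope.

(** The linear program on the cylinder is invariant under rotation, so averaging
    a feasible solution over the n rotations loses nothing: only functions y
    that are constant along each cycle, y (r, c) = v r, need be considered.  The
    total of such a y is n times the sum of v.  A ball of radius l around
    (j, c0) meets row r only if |r - j| <= l, and then in an arc of at most
    2 (l - |r - j|) + 1 vertices, with equality unless the cycle is so short
    that the arc wraps around.  Hence a v >= 0 with

      3 v_j + v_(j-1) + v_(j+1) <= 1   and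
      5 v_j + 3 v_(j-1) + 3 v_(j+1) + v_(j-2) + v_(j+2) <= 2

    for every row j gives a feasible y whatever the length n.  This is a linear
    program in m variables that does not involve n, and the stated coefficient
    is the sum of an optimal v.  For each m the table [row_weights] lists such
    a v over a common denominator, and the inequalities are checked by
    computation in binary arithmetic ([row_weights_certified]).

    The bound on the size of the arcs is [card_ball_row], deduced from
    the fact that a walk spends at least |r - j| of its steps on changing rows
    ([walk_in_arc]).  Feasibility of y is [mp_f2_cylinder_ge], and
    [row_packing_bound] turns a successful computation into a lower bound. *)

(** * Balls in the cylinder *)

(** The arc of radius [k] around [c0], read from its first vertex, which is [k]
    steps before [c0].  The sequence may wrap around the cycle and then has
    repetitions; as only an upper bound on the number of its elements matters,
    this avoids treating short cycles separately. *)
Definition cycle_arc (n : nat) (c0 : 'I_n) (k : nat) : seq 'I_n :=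
  [seq iter i (@ordS n) (iter k (@ord_pred n) c0) | i <- iota 0 k.*2.+1].

Lemma iter_ordS_pred (n k : nat) (c : 'I_n) :
  iter k (@ordS n) (iter k (@ord_pred n) c) = c.
Proof. by elim: k => //= k IHk; rewrite -iterS iterSr ord_predK. Qed.

Lemma cycle_arcP (n : nat) (c0 c : 'I_n) (k : nat) :
  reflect (exists2 i, (i <= k.*2)%N &
             c = iter i (@ordS n) (iter k (@ord_pred n) c0))
          (c \in cycle_arc n c0 k).
Proof.
apply: (iffP mapP) => -[i]; rewrite ?mem_iota => ik ->; exists i => //.
by rewrite mem_iota.
Qed.

Lemma cycle_arc_center (n : nat) (c : 'I_n) (k : nat) : c \in cycle_arc n c k.
Proof. by apply/cycle_arcP; exists k; [lia | rewrite iter_ordS_pred]. Qed.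

Lemma cycle_arcS (n : nat) (c0 c c' : 'I_n) (k : nat) :
  c' \in cycle_arc n c0 k -> [|| c == c', ordS c == c' | ordS c' == c] ->
  c \in cycle_arc n c0 k.+1.
Proof.
have up i : iter i (@ordS n) (iter k (@ord_pred n) c0) =
            iter i.+1 (@ordS n) (iter k.+1 (@ord_pred n) c0).
  by rewrite iterSr iterS ord_predK.
case/cycle_arcP=> i ik ->; case/or3P => [/eqP ->|/eqP cS|/eqP <-].
- by apply/cycle_arcP; exists i.+1; [lia | rewrite up].
- apply/cycle_arcP; exists i; first by lia.
  by apply: (can_inj (@ordSK n)); rewrite cS up.
- by apply/cycle_arcP; exists i.+2; [lia | rewrite up].
Qed.

Lemma cycle_arc_sub (n : nat) (c0 c : 'I_n) (k k' : nat) :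
  (k <= k')%N -> c \in cycle_arc n c0 k -> c \in cycle_arc n c0 k'.
Proof.
move=> /subnKC <-; elim: (k' - k)%N => [|d IHd]; first by rewrite addn0.
by move=> /IHd/cycle_arcS; rewrite addnS; apply; rewrite eqxx.
Qed.

Definition natdist (r j : nat) : nat := (r - j + (j - r))%N.

(** A walk has to use at least one step per row that it crosses; only the other
    steps can move it along the cycle. *)
Lemma walk_in_arc (m n : nat) (p : seq ('I_m * 'I_n)) (x : 'I_m * 'I_n) :
  path (@sedge (cprod_graph (path_graph m) (cycle_graph n))) x p ->
  (natdist x.1 (last x p).1 <= size p)%N /\
  x.2 \in cycle_arc n (last x p).2 (size p - natdist x.1 (last x p).1).
Proof.
elim: p x => [|z p IHp] x /=.
  by move=> _; rewrite /natdist subnn; split=> //; exact: cycle_arc_center.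
case/andP=> xz /IHp []; set y := last z p => zy arc.
case/orP: xz => /andP [/eqP e].
- rewrite {}e => /andP [_ adj]; split; first exact: leqW.
  by rewrite subSn //; apply: cycle_arcS arc _; rewrite adj orbT.
- rewrite /sedge /= /path_rel {}e => adj; have d1 : natdist x.1 z.1 = 1%N.
    by rewrite /natdist; case/orP: adj => /eqP; lia.
  (* The new step changes the row distance to the end by at most one. *)
  move: zy arc; rewrite /natdist in d1 * => zy arc; split; first by lia.
  by apply: cycle_arc_sub arc; lia.
Qed.

Lemma gdist_leP (G : sgraph) (x y : G) (l : nat) :
  gdist_le x y l -> exists2 k, (k <= l)%N & has_walk x y k.
Proof.
rewrite /gdist_le /gdist; case: pselect => // ex; case: ex_minnP => k w _ kl.
by exists k.
Qed.

(** The number of vertices of row [r] in a ball of radius [l] around a vertex of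
    row [j]: 2 (l - |r - j|) + 1 when |r - j| <= l.  Otherwise both truncated
    subtractions give 0, as they should. *)
Definition ball_row (l j r : nat) : nat := ((l.+1 - natdist r j).*2 - 1)%N.

Lemma card_ball_row (m n l : nat) (j : 'I_m * 'I_n) (r : 'I_m) :
  (#|[pred c : 'I_n | @gdist_le (cprod_graph (path_graph m) (cycle_graph n))
                 (r, c) j l]| <= ball_row l j.1 r)%N.
Proof.
pose s := if (natdist r j.1 <= l)%N
          then cycle_arc n j.2 (l - natdist r j.1) else [::].
have <- : size s = ball_row l j.1 r.
  by rewrite /s /ball_row; case: leqP => h; rewrite ?size_map ?size_iota /=; lia.
apply: leq_trans (card_size s); apply/subset_leq_card/fintype.subsetP => c.
rewrite inE => /gdist_leP [k kl /existsP [p /andP [/walk_in_arc + /eqP e]]].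
rewrite e size_tuple /= => -[dk arc]; rewrite /s (leq_trans dk kl).
by apply: cycle_arc_sub arc; lia.
Qed.

(** * Solutions that are constant along the cycles *)

Lemma mp_f2_ge (R : realType) (G : sgraph) (y : G -> R) :
  mp_feasible y -> \sum_i y i <= mp_f2 R G.
Proof.
move=> fy; apply: (ub_le_sup (proj2 (mp_values_has_sup R G))).
by exists y.
Qed.

(** Grouping a ball by rows reduces the constraints of the cylinder to
    constraints on [v] in which [n] does not occur. *)
Lemma mp_f2_cylinder_ge (R : realType) (m n : nat) (v : nat -> R) :
  (forall r, 0 <= v r) ->
  (forall j l, (j < m)%N -> (1 <= l <= 2)%N ->
     \sum_(r < m) v r * (ball_row l j r)%:R <= l%:R) ->
  (\sum_(r < m) v r) * n%:R <=
    mp_f2 R (cprod_graph (path_graph m) (cycle_graph n)).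
Proof.
move=> v_ge0 vl; set G := cprod_graph _ _.
have -> : (\sum_(r < m) v r) * n%:R = \sum_(i : G) v i.1.
  rewrite -(pair_bigA _ (fun (r : 'I_m) (c : 'I_n) => v r)) mulr_suml /=.
  by apply: eq_bigr => r _; rewrite sumr_const card_ord mulr_natr.
apply: mp_f2_ge; split=> [i|j l hl]; first exact: v_ge0.
apply: le_trans (vl j.1 l (ltn_ord _) hl).
have -> : \sum_(i : G | gdist_le i j l) v i.1 =
    \sum_(r < m) \sum_(c < n | @gdist_le G (r, c) j l) v r.
  by rewrite pair_big_dep; apply: eq_big => -[r c].
apply: ler_sum => r _; rewrite sumr_const -[leLHS]mulr_natr.
by apply: ler_wpM2l; rewrite ?ler_nat ?card_ball_row.
Qed.

(** * Certificates in binary arithmetic *)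

Definition ball_load (w : seq N) (l j : nat) : N :=
  foldr N.add 0%num
    [seq (nth 0 w r * bin_of_nat (ball_row l j r))%num | r <- iota 0 (size w)].

(** The weights are [w] divided by the common denominator [D], so the
    constraints are multiplied by [D] to stay within the integers. *)
Definition row_packing (D : N) (w : seq N) : bool :=
  (0 <? D)%num &&
  all (fun j => all (fun l => (ball_load w l j <=? bin_of_nat l * D)%num)
                    [:: 1; 2]%N)
      (iota 0 (size w)).

Lemma nat_of_bin_sum (s : seq N) :
  nat_of_bin (foldr N.add 0%num s) = (\sum_(x <- s) nat_of_bin x)%N.
Proof. by elim: s => [|x s IHs] /=; rewrite ?big_nil // big_cons -IHs; lia. Qed.

Lemma nat_of_bin_load (w : seq N) (l j : nat) :
  nat_of_bin (ball_load w l j) =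
  (\sum_(r < size w) nat_of_bin (nth 0%num w r) * ball_row l j r)%N.
Proof.
rewrite nat_of_bin_sum big_map -{1}[size w]subn0 big_mkord.
apply: eq_bigr => r _.
by rewrite -[X in (_ = _ * X)%N]bin_of_natK; lia.
Qed.

Lemma row_packing_bound (R : realType) (n : nat) (D : N) (w : seq N) :
  row_packing D w ->
  (nat_of_bin (foldr N.add 0%num w))%:R / (nat_of_bin D)%:R * n%:R <=
    mp_f2 R (cprod_graph (path_graph (size w)) (cycle_graph n)).
Proof.
case/andP=> D_gt0 /allP packed.
have D0 : 0 < (nat_of_bin D)%:R :> R by rewrite ltr0n; lia.
pose v r : R := (nat_of_bin (nth 0%num w r))%:R / (nat_of_bin D)%:R.
have -> : (nat_of_bin (foldr N.add 0%num w))%:R / (nat_of_bin D)%:R =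
          \sum_(r < size w) v r.
  by rewrite nat_of_bin_sum (big_nth 0%num) big_mkord natr_sum mulr_suml.
apply: mp_f2_cylinder_ge => [r|j l jm hl].
  by rewrite mulr_ge0 ?ler0n // invr_ge0 ler0n.
rewrite (eq_bigr (fun r : 'I_(size w) =>
  (nat_of_bin (nth 0%num w r) * ball_row l j r)%:R / (nat_of_bin D)%:R));
  last first.
  by move=> r _; rewrite natrM mulrAC.
rewrite -mulr_suml -natr_sum -nat_of_bin_load ler_pdivrMr // -natrM ler_nat.
have /allP/(_ l) : all (fun l => (ball_load w l j <=? bin_of_nat l * D)%num)
                    [:: 1; 2]%N by apply: packed; rewrite mem_iota.
rewrite !inE -[X in (_ <= X * _)%N]bin_of_natK => /(_ ltac:(lia)); lia.
Qed.

(** Large natural number literals are decimal strings under an evaluation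
    function.  Reading the string as a binary number instead means that the
    large coefficients never have to be expanded to unary form. *)
Lemma nat_of_pos_of_uint (d : Decimal.uint) (p : positive) :
  nat_of_pos (Pos.of_uint_acc d p) = Nat.of_uint_acc d (nat_of_pos p).
Proof.
elim: d p => // d IHd p; apply: etrans (IHd _) _.
all: apply: (congr1 (Nat.of_uint_acc d)).
all: by rewrite PeanoNat.Nat.tail_mul_spec; lia.
Qed.

Lemma nat_of_decimal (d : Decimal.uint) :
  Nat.of_num_uint (Number.UIntDecimal d) =
  N.of_num_uint (Number.UIntDecimal d) :> nat.
Proof.
rewrite /Nat.of_num_uint /Nat.of_uint /N.of_num_uint /N.of_uint.
by elim: d => //= d _; rewrite nat_of_pos_of_uint.
Qed.

(** * The optimal weights *)

Definition coeff_frac (m : nat) : N * N :=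
  match m with
  | 2%N => (1, 2)
  | 3%N => (2, 3)
  | 4%N => (4, 5)
  | 5%N => (26, 27)
  | 6%N => (29, 26)
  | 7%N => (19, 15)
  | 8%N => (212, 149)
  | 9%N => (52, 33)
  | 10%N => (780, 451)
  | 11%N => (81, 43)
  | 12%N => (273, 134)
  | 13%N => (5042, 2301)
  | 14%N => (2324, 991)
  | 15%N => (5690, 2277)
  | 16%N => (15593, 5878)
  | 17%N => (28417, 10125)
  | 18%N => (103240, 34873)
  | 19%N => (3896, 1251)
  | 20%N => (337976, 103415)
  | 21%N => (304705, 89043)
  | 22%N => (548313, 153338)
  | _ => (0, 1)
  end%num.

(** A common denominator and the numerators of an optimal solution, symmetric
    under reflection of the path, of the linear program in the rows. *)
Definition row_weights (m : nat) : N * seq N :=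
  match m with
  | 2%N => (4, [:: 1; 1])
  | 3%N => (3, [:: 1; 0; 1])
  | 4%N => (10, [:: 3; 1; 1; 3])
  | 5%N => (27, [:: 8; 3; 4; 3; 8])
  | 6%N => (52, [:: 16; 4; 9; 9; 4; 16])
  | 7%N => (30, [:: 9; 3; 4; 6; 4; 3; 9])
  | 8%N => (149, [:: 45; 14; 23; 24; 24; 23; 14; 45])
  | 9%N => (33, [:: 10; 3; 5; 6; 4; 6; 5; 3; 10])
  | 10%N => (451, [:: 136; 43; 66; 81; 64; 64; 81; 66; 43; 136])
  | 11%N => (86, [:: 26; 8; 13; 15; 12; 14; 12; 15; 13; 8; 26])
  | 12%N => (268, [:: 81; 25; 40; 48; 36; 43; 43; 36; 48; 40; 25; 81])
  | 13%N => (2301, [:: 695; 216; 343; 408; 320; 357; 364; 357; 320; 408; 343;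
       216; 695])
  | 14%N => (1982, [:: 599; 185; 297; 351; 272; 317; 303; 303; 317; 272; 351;
       297; 185; 599])
  | 15%N => (2277, [:: 688; 213; 340; 405; 312; 360; 359; 336; 359; 360; 312;
       405; 340; 213; 688])
  | 16%N => (11756, [:: 3552; 1100; 1757; 2085; 1620; 1856; 1832; 1791; 1791;
       1832; 1856; 1620; 2085; 1757; 1100; 3552])
  | 17%N => (20250, [:: 6119; 1893; 3028; 3594; 2780; 3213; 3151; 3048; 3182;
       3048; 3151; 3213; 2780; 3594; 3028; 1893; 6119])
  | 18%N => (34873, [:: 10537; 3262; 5211; 6192; 4792; 5515; 5454; 5241; 5416;
       5416; 5241; 5454; 5515; 4792; 6192; 5211; 3262; 10537])
  | 19%N => (1251, [:: 378; 117; 187; 222; 172; 198; 195; 189; 194; 192; 194;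
       189; 195; 198; 172; 222; 187; 117; 378])
  | 20%N => (103415, [:: 31248; 9671; 15458; 18357; 14208; 16376; 16133; 15570;
       16119; 15848; 15848; 16119; 15570; 16133; 16376; 14208; 18357; 15458;
       9671; 31248])
  | 21%N => (178086, [:: 53810; 16656; 26617; 31611; 24476; 28182; 27796; 26835;
       27665; 27432; 27250; 27432; 27665; 26835; 27796; 28182; 24476; 31611;
       26617; 16656; 53810])
  | 22%N => (306676, [:: 92665; 28681; 45840; 54432; 42148; 48547; 47835; 46236;
       47680; 47080; 47169; 47169; 47080; 47680; 46236; 47835; 48547; 42148;
       54432; 45840; 28681; 92665])
  | _ => (1, [::])
  end%num.

Lemma mp_coeff_frac (R : realType) (m : nat) :
  (2 <= m <= 22)%N ->
  mp_coeff R m =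
  (nat_of_bin (coeff_frac m).1)%:R / (nat_of_bin (coeff_frac m).2)%:R.
Proof.
have frac_eq (a b p q : nat) : a = p -> b = q -> a%:R / b%:R = p%:R / q%:R :> R.
  by move=> -> ->.
(* For m = 2 the numerator is the unit of the ring, which is 1%:R only up to
   conversion. *)
case: m => [//|[//|[_|m]]]; first exact: frac_eq 1%N _ _ _ _ _.
do 20 (case: m => [_|m]; first by
  refine (frac_eq _ _ _ _ _ _); first [exact: nat_of_decimal | exact: erefl]).
by [].
Qed.

Definition weights_certified (m : nat) : bool :=
  let: (p, q) := coeff_frac m in let: (D, w) := row_weights m in
  [&& size w == m, row_packing D w, (0 <? q)%num &
      (p * D =? foldr N.add 0 w * q)%num].

Lemma row_weights_certified (m : nat) :
  (2 <= m <= 22)%N -> weights_certified m.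
Proof.
move=> hm; have /allP : all weights_certified (iota 2 21) by vm_compute.
by apply; rewrite mem_iota.
Qed.

Theorem theorem9 (R : realType) (m n : nat) (hm : (2 <= m <= 22)%N)
    (hn : (3 <= n)%N) :
  mp_coeff R m * n%:R <= mp_f2 R (cprod_graph (path_graph m) (cycle_graph n)).
Proof.
rewrite mp_coeff_frac //; have := row_weights_certified m hm.
rewrite /weights_certified; case: (coeff_frac m) => p q.
case: (row_weights m) => D w /and4P [/eqP <- packed q_gt0 pD] /=.
have -> : (nat_of_bin p)%:R / (nat_of_bin q)%:R =
          (nat_of_bin (foldr N.add 0%num w))%:R / (nat_of_bin D)%:R :> R.
  have D_gt0 : (0 <? D)%num by case/andP: packed.
  apply/eqP; rewrite eqr_div ?pnatr_eq0; try lia.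
  by rewrite -!natrM eqr_nat; lia.
exact: row_packing_bound.
Qed.
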